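(* Let $1<q<\infty$. The minimal constant $C_{1,\infty}(q)>0$ for which $$\sup_{n\in\mathbb{N}} na_n\leq C_{1,\infty}(q)\sup_{n\in\mathbb{N}}\,n\left(\frac{1}{n}\sum_{k=n}^\infty a_k^q\right)^{\frac{1}{q}}$$ holds for all real sequences $(a_n)_{n\in\mathbb{N}}$ with $a_1\geq a_2\geq\ldots\geq 0$ is $$C_{1,\infty}(q)=\left(\frac{1}{q}\right)^{-\frac{1}{q}}\left(1-\frac{1}{q}\right)^{-\left(1-\frac{1}{q}\right)}.$$
   Context: $\mathbb{N}=\{1,2,3,\ldots\}$. Suprema and sums of nonnegative terms take values in $[0,\infty]$. *)

(* Defs.v *)
From HB Require Import structures.
From mathcomp Require Import all_boot all_order all_algebra.
From mathcomp Require Import all_classical all_reals all_analysis.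

Set Implicit Arguments.
Unset Strict Implicit.
Unset Printing Implicit Defensive.

Import Order.TTheory GRing.Theory Num.Theory.
Import numFieldNormedType.Exports.

Local Open Scope classical_set_scope.
Local Open Scope ring_scope.

(* Sequences are indexed by n >= 1; the value [a 0] is irrelevant everywhere. *)
Definition nonneg_decreasing (R : realType) (a : R^nat) : Prop :=
  forall n, (1 <= n)%N -> 0 <= a n /\ a n.+1 <= a n.

Definition sup_lhs (R : realType) (a : R^nat) : \bar R :=
  ereal_sup [set (n%:R * a n)%:E | n in [set n | (1 <= n)%N]].

Definition sup_rhs (R : realType) (q : R) (a : R^nat) : \bar R :=
  ereal_sup
    [set (n%:R%:E * ((n%:R^-1)%:E * \sum_(n <= k <oo) (a k `^ q)%:E) `^ q^-1)%E
    | n in [set n | (1 <= n)%N]].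

Definition admissible_constants (R : realType) (q : R) : set R :=
  [set C | 0 < C /\ forall a : R^nat, nonneg_decreasing a ->
                      (sup_lhs a <= C%:E * sup_rhs q a)%E].

Definition is_minimum (R : realType) (A : set R) (x : R) : Prop :=
  A x /\ lbound A x.

(* Main.v *)
Require Import Defs.
From mathcomp Require Import all_boot all_order all_algebra.
From mathcomp Require Import all_classical all_reals all_analysis.
From mathcomp Require Import ring lra.
Import Order.TTheory GRing.Theory Num.Theory.
Local Open Scope ring_scope.

(** With [t = 1/q] the constant is [K = t^(-t) (1-t)^(-(1-t))], which is the
    best constant in the weighted inequality of arithmetic and geometric means
    [K x^(1-t) y^t <= x + y], with equality exactly at [x : y = (1-t) : t].
    When the tail sum from [m] on is [s], the term of index [m] on the
    right-hand side is [m^(1-t) s^t] ([weighted_tailE]), so both halves of the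
    theorem are read off from this inequality.

    Upper bound: monotonicity gives [sum_(k >= m) a_k^q >= (N+1-m) a_N^q] for
    [m <= N], hence the term of index [m] is at least
    [m^(1-t) (N+1-m)^t a_N].  The extra [+1] leaves room to round: there is an
    integer [m] with [m >= (1-t)N] and [N+1-m >= tN], so that the equality case
    bounds [N a_N] by [K] times this term, with no loss
    ([admissible_weighted_amgm_const]).

    Sharpness: for the indicator sequence of [{1, .., N}] the left-hand side is
    [N], and the terms on the right are [m^(1-t) (N+1-m)^t], at most [(N+1)/K]
    by the inequality of means ([sup_rhs_step_le]).  Any admissible [C]
    therefore satisfies [K N <= C (N+1)] for all [N], that is [K <= C]. *)

Definition weighted_amgm_const (R : realType) (t : R) : R :=
  t `^ (- t) * (1 - t) `^ (- (1 - t)).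

Section WeightedAMGM.
Variables (R : realType) (t : R).
Hypotheses (t0 : 0 < t) (t1 : t < 1).
Local Notation K := (weighted_amgm_const R t).

Let u0 : 0 < 1 - t. Proof. by rewrite subr_gt0. Qed.

Lemma weighted_amgm_const_gt0 : 0 < K.
Proof. by rewrite mulr_gt0 ?powR_gt0. Qed.

Lemma powR_mul_complement (s : R) : 0 <= s -> s `^ (1 - t) * s `^ t = s.
Proof.
move=> s0; rewrite -powRD ?subrK ?powRr1 //.
by rewrite oner_eq0.
Qed.

Lemma weighted_amgm_constM (x y : R) : 0 <= x -> 0 <= y ->
  K * (x `^ (1 - t) * y `^ t) = (x / (1 - t)) `^ (1 - t) * (y / t) `^ t.
Proof.
move=> x0 y0; rewrite !powRM ?invr_ge0 ?(ltW u0) ?(ltW t0) //.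
rewrite /weighted_amgm_const -(powR_inv1 (ltW u0)) -(powR_inv1 (ltW t0)).
by rewrite -!powRrM !mulN1r; ring.
Qed.

Lemma weighted_amgm_eq (s : R) : 0 <= s ->
  K * (((1 - t) * s) `^ (1 - t) * (t * s) `^ t) = s.
Proof.
move=> s0; rewrite weighted_amgm_constM ?mulr_ge0 ?(ltW u0) ?(ltW t0) //.
rewrite ![_ * s]mulrC !mulfK ?lt0r_neq0 //.
exact: powR_mul_complement.
Qed.

(** Young's inequality for the conjugate exponents [1/(1-t)] and [1/t], applied
    to [(x/(1-t))^(1-t)] and [(y/t)^t]. *)
Lemma weighted_amgm (x y : R) : 0 <= x -> 0 <= y ->
  K * (x `^ (1 - t) * y `^ t) <= x + y.
Proof.
move=> x0 y0; rewrite weighted_amgm_constM //.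
have uV0 : 0 < (1 - t)^-1 by rewrite invr_gt0.
have tV0 : 0 < t^-1 by rewrite invr_gt0.
have conj : (1 - t)^-1^-1 + t^-1^-1 = 1 by rewrite !invrK subrK.
apply: le_trans (conjugate_powR (powR_ge0 _ _) (powR_ge0 _ _) uV0 tV0 conj) _.
rewrite -!powRrM !mulfV ?lt0r_neq0 // !powRr1 ?mulr_ge0 ?(ltW uV0) ?(ltW tV0) //.
by rewrite !invrK !mulfVK ?lt0r_neq0.
Qed.

(** Round the maximiser [(1-t)N] of [x^(1-t) (N-x)^t] up to
    [m = floor((1-t)N) + 1]: this can only increase [x^(1-t)], and it decreases
    [N - x] by at most [1], which having [N + 1] in place of [N] makes up for.
    Taking the floor plus one, not the ceiling, still leaves [m <= N] because
    [(1-t)N < N]. *)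
Lemma exists_rounded_maximiser (N : nat) : (1 <= N)%N ->
  exists2 m : nat, (1 <= m <= N)%N &
    N%:R <= K * (m%:R `^ (1 - t) * (N.+1 - m)%:R `^ t).
Proof.
move=> N1; have N0 : 0 < N%:R :> R by rewrite ltr0n.
have x0 : 0 <= (1 - t) * N%:R by rewrite mulr_ge0 ?ltW.
have /andP[lex ltx] := truncn_itv x0.
set p := Num.trunc _ in lex ltx.
have pN : (p < N)%N.
  by rewrite -(ltr_nat R) (le_lt_trans lex) // gtr_pMl // ltrBlDr ltrDl.
exists p.+1 => //.
rewrite -{1}(weighted_amgm_eq _ (ltW N0)).
rewrite ler_pM2l ?weighted_amgm_const_gt0 // ler_pM ?powR_ge0 //.
  by rewrite ge0_ler_powR ?nnegrE ?(ltW u0) ?(ltW ltx).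
rewrite ge0_ler_powR ?nnegrE ?mulr_ge0 ?(ltW t0) //.
by rewrite subSS natrB 1?ltnW //; lra.
Qed.

End WeightedAMGM.

Lemma weighted_tailE (R : realType) (t s : R) (n : nat) : (1 <= n)%N ->
  0 <= s ->
  (n%:R%:E * ((n%:R^-1)%:E * s%:E) `^ t)%E = (n%:R `^ (1 - t) * s `^ t)%:E.
Proof.
move=> n1 s0; have n0 : 0 < n%:R :> R by rewrite ltr0n.
rewrite -(EFinM n%:R^-1) poweR_EFin -EFinM powRM ?invr_ge0 ?(ltW n0) //.
rewrite -(powR_inv1 (ltW n0)) -powRrM mulN1r mulrA.
by rewrite powRB ?(gt_eqF n0) ?implybT // powRr1 ?(ltW n0) // powRN.
Qed.

Lemma nonneg_decreasing_le (R : realType) (a : R^nat) (k n : nat) :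
  nonneg_decreasing a -> (1 <= k)%N -> (k <= n)%N -> a n <= a k.
Proof.
move=> ha k1; elim: n => [|n IH]; first by rewrite leqn0 => /eqP ->.
rewrite leq_eqVlt => /predU1P[<- //|]; rewrite ltnS => kn.
exact: le_trans (proj2 (ha n (leq_trans k1 kn))) (IH kn).
Qed.

Lemma tail_sum_ge (R : realType) (q : R) (a : R^nat) (m N : nat) :
  0 <= q -> nonneg_decreasing a -> (1 <= m <= N)%N ->
  (((N.+1 - m)%:R * a N `^ q)%:E <= \sum_(m <= k <oo) (a k `^ q)%:E)%E.
Proof.
move=> q0 ha /andP[m1 mN].
apply: le_trans (nneseries_lim_ge N.+1 _); last first.
  by move=> k _ _; rewrite lee_fin powR_ge0.
have aN0 : 0 <= a N by case: (ha N (leq_trans m1 mN)).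
rewrite sumEFin lee_fin mulr_natl -sumr_const_nat.
rewrite !big_nat; apply: ler_sum => k /andP[mk kN].
have akN : a N <= a k by apply: nonneg_decreasing_le => //; exact: leq_trans mk.
by rewrite ge0_ler_powR ?nnegrE // (le_trans aN0).
Qed.

Lemma admissible_weighted_amgm_const (R : realType) (q : R) : 1 < q ->
  admissible_constants q (weighted_amgm_const R q^-1).
Proof.
move=> q1; have q0 : 0 < q by apply: lt_trans q1.
have t0 : 0 < q^-1 by rewrite invr_gt0.
have t1 : q^-1 < 1 by rewrite invf_lt1.
have K0 := weighted_amgm_const_gt0 R q^-1 t0 t1.
split=> // a ha; apply: ge_ereal_sup => _ [N /= N1 <-].
have [aN0 _] := ha N N1.
have [m mN Nle] := exists_rounded_maximiser R q^-1 t0 t1 N N1.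
have /andP[m1 _] := mN.
apply: (@le_trans _ _ (weighted_amgm_const R q^-1 *
    (m%:R `^ (1 - q^-1) * ((N.+1 - m)%:R * a N `^ q) `^ q^-1))%:E).
  rewrite lee_fin powRM ?powR_ge0 // -powRrM mulfV ?lt0r_neq0 // powRr1 //.
  by rewrite (mulrA (m%:R `^ _)) (mulrA (weighted_amgm_const _ _)) ler_wpM2r.
rewrite EFinM lee_pmul2l // -weighted_tailE ?mulr_ge0 ?powR_ge0 //.
apply: le_trans; last by apply: ereal_sup_ubound; exists m.
have le_tail := tail_sum_ge R q a m N (ltW q0) ha mN.
have c0 : (0 <= ((N.+1 - m)%:R * a N `^ q)%:E)%E.
  by rewrite lee_fin mulr_ge0 ?powR_ge0.
rewrite lee_wpmul2l ?lee_fin // gt0_ler_poweR ?(ltW t0) //.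
- by rewrite in_itv /= leey mule_ge0 ?lee_fin ?invr_ge0.
- rewrite in_itv /= leey mule_ge0 ?lee_fin ?invr_ge0 //.
  exact: le_trans c0 le_tail.
- by rewrite lee_wpmul2l ?lee_fin ?invr_ge0.
Qed.

Definition step_seq (R : realType) (N : nat) : R^nat := fun k => (k <= N)%:R.

Lemma nonneg_decreasing_step (R : realType) (N : nat) :
  nonneg_decreasing (step_seq R N).
Proof.
move=> n _; rewrite /step_seq ler0n ler_nat; split=> //.
by case: (leqP n.+1 N) => // /ltnW ->.
Qed.

Lemma step_tail_sum (R : realType) (q : R) (N n : nat) : q != 0 ->
  (\sum_(n <= k <oo) (step_seq R N k `^ q)%:E = (N.+1 - n)%:R%:E)%E.
Proof.
move=> q0; rewrite (nneseries_split n (N.+1 - n)); last first.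
  by move=> k _; rewrite lee_fin powR_ge0.
rewrite [X in (_ + X)%E]eseries0 ?adde0; last first.
  move=> k; rewrite -maxnE geq_max => /andP[_ Nk] _.
  by rewrite /step_seq leqNgt Nk powR0.
rewrite sumEFin; congr EFin.
transitivity (\sum_(n <= k < n + (N.+1 - n)) (1 : R)).
  rewrite !big_nat; apply: eq_bigr => k /andP[nk].
  rewrite -maxnE leq_max ltnS => /orP[|kN]; first by rewrite ltnNge nk.
  by rewrite /step_seq kN powR1.
by rewrite sumr_const_nat addKn.
Qed.

Lemma sup_rhs_step_le (R : realType) (q : R) (N : nat) : 1 < q ->
  (sup_rhs q (step_seq R N) <= (N.+1%:R / weighted_amgm_const R q^-1)%:E)%E.
Proof.
move=> q1; have q0 : 0 < q by apply: lt_trans q1.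
have t0 : 0 < q^-1 by rewrite invr_gt0.
have t1 : q^-1 < 1 by rewrite invf_lt1.
have K0 := weighted_amgm_const_gt0 R q^-1 t0 t1.
apply: ge_ereal_sup => _ [n /= n1 <-].
rewrite step_tail_sum ?lt0r_neq0 // weighted_tailE // lee_fin.
rewrite ler_pdivlMr // mulrC.
have [nN|Nn] := leqP n N.+1.
  have := weighted_amgm R q^-1 t0 t1 n%:R (N.+1 - n)%:R.
  by rewrite -natrD subnKC //; apply.
have /eqP -> : (N.+1 - n == 0)%N by rewrite subn_eq0 ltnW.
by rewrite powR0 ?lt0r_neq0 // !mulr0.
Qed.

Theorem theorem3p3 (R : realType) (q : R) (hq : 1 < q) :
  is_minimum (admissible_constants q)
    ((1 / q) `^ (- (1 / q)) * (1 - 1 / q) `^ (- (1 - 1 / q))).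
Proof.
rewrite div1r -/(weighted_amgm_const R q^-1).
split; first exact: admissible_weighted_amgm_const.
move=> C [C0 hC]; set K := weighted_amgm_const R q^-1.
have q0 : 0 < q by apply: lt_trans hq.
have K0 : 0 < K.
  by apply: weighted_amgm_const_gt0; rewrite ?invr_gt0 ?invf_lt1.
have step_bound N : (1 <= N)%N -> K * N%:R <= C * N.+1%:R.
  move=> N1.
  have : (N%:R%:E <= (C * (N.+1%:R / K))%:E)%E.
    apply: (@le_trans _ _ (sup_lhs (step_seq R N))).
      apply: ereal_sup_ubound; exists N => //=.
      by rewrite /step_seq leqnn mulr1.
    apply: le_trans (hC _ (nonneg_decreasing_step R N)) _.
    by rewrite EFinM lee_pmul2l // sup_rhs_step_le.
  by rewrite lee_fin mulrA ler_pdivlMr // mulrC.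
rewrite leNgt; apply/negP => CK.
(* An index [N > C / (K - C)] contradicts [(K - C) N <= C]. *)
have KC0 : 0 < K - C by rewrite subr_gt0.
have := truncnS_gt (C / (K - C)); set N := (Num.trunc _).+1.
rewrite ltr_pdivrMr // => CN.
have := step_bound N isT; rewrite -natr1; lra.
Qed.
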